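(* Let $q$ be a prime power, $n\ge2$, $0<k<n-1$, and let $m<n$ be a positive integer. Let $X$ be a $k$-dimensional subspace of $E=\mathbb F_q^n$ and let $\mathcal M=\mathcal{AU}_{k,n}(q,X)$ be the almost uniform $q$-matroid. If $\mathcal M=\mathcal M[\mathcal C]$ for an $\mathbb F_q$-$[n\times m,k',d]$ matrix rank-metric code $\mathcal C\subseteq\mathbb F_q^{n\times m}$, then $m=n-1$ and $\mathcal C$ has parameters $\mathbb F_q$-$[n\times(n-1),k(n-1),n-k]$.
   Context: $\mathcal L(E)$ is the set of subspaces of $E$. $\mathcal{AU}_{k,n}(q,X)=(\mathcal L(E),\rho)$ with $\rho(V)=k-1$ if $V=X$ and $\rho(V)=\min\{\dim V,k\}$ otherwise (equivalently, the $q$-matroid whose bases are the $k$-dimensional subspaces other than $X$). An $\mathbb F_q$-$[n\times m,k',d]$ code is an $\mathbb F_q$-linear subspace $\mathcal C\subseteq\mathbb F_q^{n\times m}$ of $\mathbb F_q$-dimension $k'$ whose minimum rank over nonzero elements is $d$. $\mathcal M[\mathcal C]$ has rank function $\rho_{\mathcal C}(U)=(k'-\dim\mathcal C(U^\perp))/m$ where $\mathcal C(W)=\{M\in\mathcal C:\operatorname{colsp}(M)\subseteq W\}$ and $U^\perp$ is the orthogonal complement under the standard dot product. *)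

(* Defs.v *)
From HB Require Import structures.
From mathcomp Require Import all_boot all_order all_algebra.

Set Implicit Arguments.
Unset Strict Implicit.
Unset Printing Implicit Defensive.

Import GRing.Theory.
Local Open Scope ring_scope.

Section Defs.

Variables (F : finFieldType) (n m : nat).

Implicit Types (U V W X : {vspace 'cV[F]_n}).
Implicit Types (C : {vspace 'M[F]_(n, m)}) (M : 'M[F]_(n, m)).

(* A q-(poly)matroid on E = F^n is the pair (L(E), rho); as L(E) is the type  *)
(* {vspace 'cV[F]_n}, it is represented by rho. Values are rational because   *)
(* the rank function of a matrix code need not be integral.                   *)
Definition rank_function := {vspace 'cV[F]_n} -> rat.

(* Meant for 0 < k, so that the truncated subtraction is the usual one. *)
Definition almost_uniform (k : nat) X : rank_function :=
  fun V => if V == X then (k - 1)%:R else (minn (\dim V) k)%:R.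

Definition dotv (u v : 'cV[F]_n) : F := \sum_(i < n) u i 0 * v i 0.

(* The spans in orthv and shortened are taken of sets that are already        *)
(* subspaces: see mem_orthv and mem_shortened.                                *)
Definition orthv U : {vspace 'cV[F]_n} :=
  <<enum [pred v : 'cV[F]_n | [forall u, (u \in U) ==> (dotv u v == 0%R)]]>>%VS.

Definition colsp M : {vspace 'cV[F]_n} :=
  <<[seq col j M | j <- enum 'I_m]>>%VS.

Definition shortened C W : {vspace 'M[F]_(n, m)} :=
  <<enum [pred M : 'M[F]_(n, m) | (M \in C) && (colsp M <= W)%VS]>>%VS.

Definition code_rank C : rank_function :=
  fun U => ((\dim C)%:R - (\dim (shortened C (orthv U)))%:R) / m%:R.

Definition min_rank C (d : nat) : Prop :=
  (exists2 M, M \in C & M != 0 /\ \rank M = d) /\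
  (forall M, M \in C -> M != 0 -> (d <= \rank M)%N).

Definition code_params C (k' d : nat) : Prop := \dim C = k' /\ min_rank C d.

Lemma mem_orthv U v :
  reflect (forall u, u \in U -> dotv u v = 0) (v \in orthv U).
Proof.
have dotvD u a x y : dotv u (a *: x + y) = a * dotv u x + dotv u y.
  rewrite /dotv mulr_sumr -big_split /=; apply: eq_bigr => i _.
  by rewrite !mxE mulrDr mulrCA.
apply: (iffP idP) => [/coord_span-> u uU | vU]; last first.
  apply: memv_span; rewrite mem_enum inE.
  by apply/forallP => u; apply/implyP => /vU->.
apply: (big_ind (fun x => dotv u x = 0)) => [|x y x0 y0|i _].
- by rewrite /dotv big1 // => i _; rewrite mxE mulr0.
- by rewrite -[x]scale1r dotvD x0 y0 mulr0 addr0.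
set e := _`_i.
have : e \in enum [pred v | [forall u, (u \in U) ==> (dotv u v == 0)]].
  by apply: mem_nth; rewrite -?cardE ltn_ord.
rewrite mem_enum inE => /forallP/(_ u)/implyP/(_ uU)/eqP e0.
rewrite -[_ *: _]addr0 dotvD e0 mulr0 add0r.
by rewrite /dotv big1 // => j _; rewrite mxE mulr0.
Qed.

Lemma colsp_subP M W : reflect (forall j, col j M \in W) (colsp M <= W)%VS.
Proof.
apply: (iffP span_subvP) => [sMW j | sMW _ /mapP[j _ ->]]; last exact: sMW.
by apply/sMW/map_f; rewrite mem_enum.
Qed.

Lemma mem_shortened C W M :
  (M \in shortened C W) = (M \in C) && (colsp M <= W)%VS.
Proof.
apply/idP/idP => [/coord_span-> | MCW]; last first.
  by apply: memv_span; rewrite mem_enum inE.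
apply: (big_ind (fun x => (x \in C) && (colsp x <= W)%VS)).
- rewrite mem0v; apply/colsp_subP => j.
  by rewrite (_ : col j 0 = 0) ?mem0v //; apply/colP => i; rewrite !mxE.
- move=> x y /andP[xC /colsp_subP xW] /andP[yC /colsp_subP yW].
  rewrite memvD //; apply/colsp_subP => j.
  rewrite (_ : col j (x + y) = col j x + col j y) ?memvD //.
  by apply/colP => i; rewrite !mxE.
move=> i _; set e := _`_i.
have : e \in enum [pred M | (M \in C) && (colsp M <= W)%VS].
  by apply: mem_nth; rewrite -?cardE ltn_ord.
rewrite mem_enum inE => /andP[eC /colsp_subP eW].
rewrite memvZ //; move: (coord _ _ _) => a; apply/colsp_subP => j.
rewrite (_ : col j _ = a *: col j e) ?memvZ //.
by apply/colP => h; rewrite !mxE.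
Qed.

End Defs.

(* Main.v *)
(** Write s = n - k. Evaluating the rank function shows that dim C = k m, that
    the words of C with column space inside X^perp form an m-dimensional space,
    and that a nonzero word of rank at most s has rank exactly s and column
    space inside X^perp. This gives d = s. Now let D be the space of words of C
    whose last m - s columns vanish, so that dim D >= k m - n (m - s). A nonzero
    word of D has rank s and columns in X^perp, and its first column is nonzero
    since the rank would otherwise be less than s; so dim D <= dim X^perp = s.
    Hence k m - n (m - s) <= s, that is, m >= n - 1. *)
Require Import Defs.
From mathcomp Require Import all_boot all_order all_algebra.
From mathcomp Require Import zify.
Import GRing.Theory Num.Theory.
Local Open Scope ring_scope.

Lemma dotvC {F : finFieldType} {n : nat} (u v : 'cV[F]_n) : dotv u v = dotv v u.
Proof. by apply: eq_bigr => i _; rewrite mulrC. Qed.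

Lemma sub_orthvC {F : finFieldType} {n : nat} (U V : {vspace 'cV[F]_n}) :
  (U <= orthv V)%VS = (V <= orthv U)%VS.
Proof.
by apply/subvP/subvP => sUV v vV; apply/mem_orthv => u uU; rewrite dotvC;
  apply: (mem_orthv _ _ (sUV u uU)).
Qed.

Lemma mem_orthv_colsp {F : finFieldType} {n p : nat} (A : 'M[F]_(n, p)) v :
  (v \in orthv (colsp A)) = (v^T *m A == 0).
Proof.
have dotE j : (v^T *m A) 0 j = dotv v (col j A).
  by rewrite mxE; apply: eq_bigr => i _; rewrite !mxE.
(* Swapping sides reduces orthogonality against the whole column space to a test on the columns of
   [A]. *)
rewrite memvE sub_orthvC; apply/colsp_subP/eqP => [Av | vA0 j].
  apply/rowP => j; rewrite dotE mxE.
  by apply: (mem_orthv _ _ (Av j)); rewrite memv_line.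
apply/mem_orthv => _ /vlineP[a ->].
transitivity (a * dotv v (col j A)); last by rewrite -dotE vA0 mxE mulr0.
rewrite /dotv mulr_sumr; apply: eq_bigr => i _.
by rewrite mxE mulrA.
Qed.

(** Rank-nullity for v |-> v^T [col_base A]: its kernel is the orthogonal complement because
    [row_base A] can be cancelled, and it is onto because [col_base A] has a left inverse. *)
Lemma dim_orthv_colsp {F : finFieldType} {n p : nat} (A : 'M[F]_(n, p)) :
  \dim (orthv (colsp A)) = (n - \rank A)%N.
Proof.
pose f := linfun (mulmxr (col_base A) \o @trmx F n 1).
have fE v : f v = v^T *m col_base A by rewrite lfunE.
have -> : orthv (colsp A) = lker f.
  apply/vspaceP => v; rewrite mem_orthv_colsp memv_ker fE.
  rewrite -[in LHS](mulmx_base A) mulmxA.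
  by rewrite mulmx_free_eq0 // row_base_free.
have fT : limg f = fullv.
  apply/vspaceP => w; rewrite memvf; apply/memv_imgP.
  have /row_fullP[B BA] := col_base_full A.
  exists (w *m B)^T; rewrite ?memvf // fE trmxK -mulmxA BA mulmx1 //.
have := limg_ker_dim f fullv; rewrite fT !dimvf /dim /= capfv muln1 mul1n.
by move/(canRL (addnK _)).
Qed.

(** Carries facts on column spaces over to arbitrary subspaces: put a basis in the columns; its
    freeness gives the rank. *)
Lemma colsp_mxE {F : finFieldType} {n : nat} (U : {vspace 'cV[F]_n}) :
  exists2 A : 'M[F]_(n, \dim U), colsp A = U & \rank A = \dim U.
Proof.
pose b := vbasis U; pose A : 'M[F]_(n, \dim U) := \matrix_(i, j) b`_j i 0.
have colA j : col j A = b`_j by apply/colP => i; rewrite !mxE.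
exists A.
  rewrite -[RHS](span_basis (vbasisP U)); congr (<<_>>%VS).
  apply: (@eq_from_nth _ 0) => [|j].
    by rewrite size_map size_enum_ord size_tuple.
  rewrite size_map size_enum_ord => ltj.
  by rewrite (nth_map (Ordinal ltj)) ?size_enum_ord // colA nth_enum_ord.
rewrite -mxrank_tr; apply/eqP; rewrite -[_ == _]/(row_free A^T).
rewrite -kermx_eq0; apply/rowV0P => c /sub_kermxP cA0.
have /freeP b_free := basis_free (vbasisP U).
apply/rowP => j; rewrite [RHS]mxE; apply: (b_free (fun j => c 0 j)).
apply/colP => i; rewrite summxE [RHS]mxE.
move/rowP/(_ i): cA0; rewrite !mxE => cA0; rewrite -[RHS]cA0.
by apply: eq_bigr => l _; rewrite !mxE.
Qed.

Lemma dim_orthv {F : finFieldType} {n : nat} (U : {vspace 'cV[F]_n}) :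
  \dim (orthv U) = (n - \dim U)%N.
Proof. by have [A UE <-] := colsp_mxE U; rewrite -dim_orthv_colsp UE. Qed.

Lemma colsp_orthv_rank {F : finFieldType} {n m : nat} (A : 'M[F]_(n, m)) U :
  (colsp A <= orthv U)%VS -> (\rank A <= n - \dim U)%N.
Proof.
rewrite sub_orthvC => /dimvS; rewrite dim_orthv_colsp => leU.
by have := rank_leq_row A; lia.
Qed.

(* A refinement of the Singleton bound [dim C <= n (t + 1)]. *)
Lemma dim_code_minrank_colsp {F : finFieldType} {n s t : nat}
    (C : {vspace 'M[F]_(n, 1 + s + t)}) (W : {vspace 'cV[F]_n}) :
    (forall M, M \in C -> M != 0 -> (\rank M <= s.+1)%N ->
       (s < \rank M)%N /\ (colsp M <= W)%VS) ->
  (\dim C <= n * t + \dim W)%N.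
Proof.
move=> minC.
(* [f] keeps the last t columns and [g] the first one, so [C :&: lker f] is the space D of words
   supported on the first 1 + s columns. *)
pose f := linfun (@rsubmx F n (1 + s) t).
pose g := linfun (@lsubmx F n 1 s \o @lsubmx F n (1 + s) t).
have fE M : f M = rsubmx M by rewrite lfunE.
have gE M : g M = lsubmx (lsubmx M) by rewrite lfunE.
have kerfE M : M \in lker f -> M = row_mx (lsubmx M) 0.
  by rewrite memv_ker fE => /eqP M0; rewrite -[LHS]hsubmxK M0.
have minD M : M \in (C :&: lker f)%VS -> M != 0 ->
    (s < \rank M)%N /\ (colsp M <= W)%VS.
  rewrite memv_cap => /andP[MC /kerfE ME] M0; apply: minC => //.
  by rewrite ME rank_row_mx0 rank_leq_col.
(* A word of D with zero first column has only s columns left, too few for a rank above s. *)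
have kerg : (C :&: lker f :&: lker g)%VS = 0%VS.
  apply/eqP; rewrite -subv0; apply/subvP => M; rewrite memv_cap => /andP[MD].
  rewrite memv_ker gE => /eqP M0; rewrite memv0; apply/eqP/eqP.
  have [//|/(minD _ MD)[+ _]] := eqVneq M 0.
  move: MD; rewrite memv_cap => /andP[_ /kerfE->].
  rewrite rank_row_mx0 -[lsubmx M]hsubmxK M0 rank_row_0mx.
  by rewrite ltnNge rank_leq_col.
have imgg : (g @: (C :&: lker f) <= W)%VS.
  apply/subvP => _ /memv_imgP[M MD ->]; rewrite gE.
  have [->|/(minD _ MD)[_ /colsp_subP sMW]] := eqVneq M 0.
    by rewrite !linear0 mem0v.
  have -> : lsubmx (lsubmx M) = col (lshift t (lshift s 0)) M; last exact: sMW.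
  by apply/colP => i; rewrite !mxE.
rewrite -(limg_ker_dim f C) -(limg_ker_dim g (C :&: lker f)%VS).
rewrite kerg dimv0 add0n addnC leq_add ?dimvS //.
by rewrite (leq_trans (dimvS (subvf _))) // dimvf.
Qed.

Lemma code_rank_shortened {F : finFieldType} {n m : nat}
    (C : {vspace 'M[F]_(n, m)}) (U : {vspace 'cV[F]_n}) (r : nat) :
    (0 < m)%N -> code_rank C U = r%:R ->
  (\dim (shortened C (orthv U)) + r * m = \dim C)%N.
Proof.
move=> m_gt0 rU; apply/eqP; rewrite -(eqr_nat rat) natrD natrM -rU /code_rank.
by rewrite divfK ?pnatr_eq0 -?lt0n // addrC subrK.
Qed.

Theorem theorem4p6 (F : finFieldType) (n k m : nat)
    (hn : (2 <= n)%N) (hk : (0 < k < n - 1)%N) (hm : (0 < m < n)%N)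
    (X : {vspace 'cV[F]_n}) (hX : \dim X = k)
    (C : {vspace 'M[F]_(n, m)}) (k' d : nat) (hC : code_params C k' d)
    (hM : almost_uniform k X =1 code_rank C) :
  m = (n - 1)%N /\ code_params C (k * (n - 1))%N (n - k)%N.
Proof.
have /andP[m_gt0 ltmn] := hm; have /andP[k_gt0 ltkn] := hk.
have dimCX : (\dim (shortened C (orthv X)) + (k - 1) * m = \dim C)%N.
  by apply: code_rank_shortened => //; rewrite -hM /almost_uniform eqxx.
have dimCU U : U != X -> (k <= \dim U)%N ->
    (\dim (shortened C (orthv U)) + k * m = \dim C)%N.
  move=> UX leU; apply: code_rank_shortened => //.
  by rewrite -hM /almost_uniform (negPf UX) (minn_idPr leU).
have dimC : \dim C = (k * m)%N.
  have dimT : \dim {:'cV[F]_n} = n by rewrite dimvf /dim /= muln1.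
  have TX : fullv != X by apply/eqP => TX; move: hX; rewrite -TX; lia.
  rewrite -(dimCU fullv) //; last by lia.
  suff -> : shortened C (orthv fullv) = 0%VS by rewrite dimv0.
  apply/eqP; rewrite -subv0; apply/subvP => M.
  rewrite mem_shortened memv0 => /andP[_ /colsp_orthv_rank].
  by rewrite dimT subnn leqn0 mxrank_eq0.
have minC M : M \in C -> M != 0 -> (\rank M <= n - k)%N ->
    (n - k <= \rank M)%N /\ (colsp M <= orthv X)%VS.
  move=> MC M0 leM; have := dim_orthv_colsp M.
  (* The test subspace is U = colsp(M)^perp, of dimension n - rank M >= k. If U is not X, it has
     full rank k, so no nonzero word has columns in U^perp; but M does. *)
  have [UX|UX] := eqVneq (orthv (colsp M)) X.
    by rewrite sub_orthvC UX subvv hX => kE; split=> //; lia.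
  have MU : M \in shortened C (orthv (orthv (colsp M))).
    by rewrite mem_shortened MC -sub_orthvC subvv.
  move=> dimU; have := dimCU _ UX; rewrite dimU dimC => dim0.
  have /eqP : \dim (shortened C (orthv (orthv (colsp M)))) = 0%N by lia.
  by rewrite dimv_eq0 => /eqP U0; move: MU; rewrite U0 memv0 (negPf M0).
(* By [dimCX] and [dimC] this shortened code has dimension m > 0. *)
have [M MCX M0] : exists2 M, M \in shortened C (orthv X) & M != 0.
  exists (vpick (shortened C (orthv X))); first exact: memv_pick.
  by rewrite vpick0 -dimv_eq0; apply/eqP => dim0; move: dimCX; nia.
have rankM : \rank M = (n - k)%N.
  move: MCX; rewrite mem_shortened => /andP[MC /colsp_orthv_rank].
  by rewrite hX => leM; have [] := minC M MC M0 leM; lia.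
have mE : m = (n - 1)%N.
  have lem : (n - k <= m)%N by rewrite -rankM rank_leq_col.
  (* The refined Singleton bound is used with s = n - k - 1: the first 1 + s columns number n - k,
     the rank of a minimal word. *)
  have mS : m = (1 + (n - k).-1 + (m - (n - k)))%N by lia.
  (* The bound rearranges to (n - k)(n - 1) <= (n - k) m; cancel n - k > 0 and use m < n. *)
  suff : (\dim C <= n * (m - (n - k)) + (n - k))%N by rewrite dimC; nia.
  (* Only the second n - k is the dimension of X^perp; the first counts columns. *)
  have := dim_orthv X; rewrite hX => {2}<-.
  move: (m - (n - k))%N mS => t mS.
  clear hM hC dimCX dimCU dimC M MCX M0 rankM lem hm m_gt0 ltmn.
  subst m; apply: dim_code_minrank_colsp => N NC N0.
  have -> : (n - k).-1.+1 = (n - k)%N by lia.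
  by move=> /(minC N NC N0); lia.
split=> //; split; first by rewrite dimC mE.
split=> [|N NC N0].
  by exists M; move: MCX; rewrite // mem_shortened => /andP[].
by case: (leqP (\rank N) (n - k)) => [/(minC N NC N0)[] | /ltnW].
Qed.
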